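(* Let $\overline{A}=(A_1,\dots,A_X)$ be a cardinality with space $\mathcal{A}$, let $d\ge1$, and let $\mathsf{H}_{\mathrm B}$ be the real vector space of Hermitian $d\times d$ matrices. A quantum assemblage $\boldsymbol{\sigma}=\{\sigma_{a|x}\}_{a,x}\in\mathcal{A}\otimes\mathsf{H}_{\mathrm B}$ has the form $$\boldsymbol{\sigma}=\frac1d\,\vec Z_{\mathcal A}\otimes\mathbb{1}_d+\boldsymbol{\Delta},\qquad\boldsymbol{\Delta}\in(\mathsf{Z}_{\mathcal A}\otimes\mathsf{C}_{\mathrm B})\oplus(\mathsf{C}_{\mathcal A}\otimes\mathsf{Z}_{\mathrm B})\oplus(\mathsf{C}_{\mathcal A}\otimes\mathsf{C}_{\mathrm B}).$$
   Context: A cardinality $\overline{A}=(A_1,\dots,A_X)$ is a finite nonempty sequence of positive integers: a device has inputs $x\in\{1,\dots,X\}$ and, for input $x$, outputs $a\in\{1,\dots,A_x\}$. The associated space is $\mathcal{A}=\mathbb{R}^{\sum_x A_x}$ with standard basis $[a|x]$. A quantum assemblage is a family of positive semidefinite $\sigma_{a|x}\in\mathsf{H}_{\mathrm B}$ ($1\le x\le X$, $1\le a\le A_x$) such that $\sum_a\sigma_{a|x}=\sum_a\sigma_{a|x'}$ for all $x,x'$ and $\frac1X\sum_{a,x}\operatorname{tr}\sigma_{a|x}=1$; it is identified with $\boldsymbol{\sigma}=\sum_{a,x}[a|x]\otimes\sigma_{a|x}\in\mathcal{A}\otimes\mathsf{H}_{\mathrm B}$. Define $\vec Z_{\mathcal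 A}=\sum_{x=1}^X\sum_{a=1}^{A_x}\frac{1}{A_x}[a|x]$; $\vec C_{\mathcal A}^{\,i|x}=\frac{1}{A_x}([i|x]-[A_x|x])$ for $1\le x\le X$, $1\le i\le A_x-1$; $\mathsf{Z}_{\mathcal A}=\mathrm{span}(\vec Z_{\mathcal A})$; $\mathsf{C}_{\mathcal A}=\mathrm{span}\{\vec C_{\mathcal A}^{\,i|x}\}_{i,x}$. In $\mathsf{H}_{\mathrm B}$: $\mathsf{Z}_{\mathrm B}=\{\alpha\mathbb{1}_d:\alpha\in\mathbb{R}\}$ and $\mathsf{C}_{\mathrm B}=\{\rho\in\mathsf{H}_{\mathrm B}:\operatorname{tr}\rho=0\}$. *)

(* Defs.v *)
From HB Require Import structures.
From mathcomp Require Import all_boot all_order all_algebra.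
From mathcomp Require Import sesquilinear.
From mathcomp Require Import complex.
From mathcomp Require Import reals.

Set Implicit Arguments.
Unset Strict Implicit.
Unset Printing Implicit Defensive.

Import Order.TTheory GRing.Theory Num.Theory.
Local Open Scope ring_scope.
Local Open Scope complex_scope.
Local Open Scope sesquilinear_scope.

Section HermitianSpace.
Variables (R : rcfType) (d : nat).

Record herm : predArgType :=
  Herm { hermval :> 'M[R[i]]_d; _ : hermval \is hermsymmx }.

HB.instance Definition _ := [isSub for hermval].
HB.instance Definition _ := [Choice of herm by <:].

Lemma hermsymmxP (M : 'M[R[i]]_d) :
  reflect (forall i j, M i j = (M j i)^*) (M \is hermsymmx).
Proof.
apply: (iffP (is_hermitianmxP _ _ _)); rewrite expr0 scale1r.
  by move=> e i j; rewrite {1}e !mxE.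
by move=> e; apply/matrixP=> i j; rewrite e !mxE.
Qed.

Lemma hermE (H : herm) i j : H i j = (H j i)^*.
Proof. by case: H => M /= /hermsymmxP. Qed.

Fact herm_zmod_closed :
  zmod_closed (hermsymmx : pred_sort (predPredType 'M[R[i]]_d)).
Proof.
split; first by apply/hermsymmxP=> i j; rewrite !mxE rmorph0.
move=> M N /hermsymmxP hM /hermsymmxP hN; apply/hermsymmxP=> i j.
by rewrite !mxE hM hN rmorphB.
Qed.

HB.instance Definition _ := GRing.isZmodClosed.Build 'M[R[i]]_d
  (hermsymmx : pred_sort (predPredType 'M[R[i]]_d)) herm_zmod_closed.
HB.instance Definition _ := [SubChoice_isSubZmodule of herm by <:].

Fact scale_herm_subproof (a : R) (H : herm) :
  a%:C *: (H : 'M_d) \is hermsymmx.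
Proof.
by apply/hermsymmxP=> i j; rewrite !mxE hermE; case: (H j i) => x y; simpc.
Qed.
Definition scale_herm a H := Herm (scale_herm_subproof a H).

Fact scale_hermA a b H : scale_herm a (scale_herm b H) = scale_herm (a * b) H.
Proof. by apply: val_inj; rewrite /= scalerA rmorphM. Qed.
Fact scale_herm1 : left_id 1 scale_herm.
Proof. by move=> H; apply: val_inj; rewrite /= scale1r. Qed.
Fact scale_hermDr : right_distributive scale_herm +%R.
Proof. by move=> a H K; apply: val_inj; rewrite /= scalerDr. Qed.
Fact scale_hermDl H : {morph scale_herm^~ H : a b / a + b}.
Proof. by move=> a b; apply: val_inj; rewrite /= rmorphD scalerDl. Qed.

HB.instance Definition _ := GRing.Zmodule_isLmodule.Build R herm
  scale_hermA scale_herm1 scale_hermDr scale_hermDl.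

Lemma hermDE (H K : herm) : hermval (H + K) = hermval H + hermval K. Proof. by []. Qed.
Lemma hermZE (a : R) (H : herm) : hermval (a *: H) = a%:C *: hermval H.
Proof. by []. Qed.

(* Real coordinates: real parts on and above the diagonal, imaginary parts
   below it. *)
Definition herm_coord (H : herm) : 'rV[R]_(d * d) :=
  mxvec (\matrix_(i, j) if (i <= j)%N then complex.Re (H i j)
                        else complex.Im (H i j)).

Definition herm_of_coord_mx (v : 'rV[R]_(d * d)) : 'M[R[i]]_d :=
  let M := vec_mx v in
  \matrix_(i, j) if i == j then (M i i)%:C else
    if (i < j)%N then M i j -i* M j i else M j i +i* M i j.

Fact herm_of_coord_subproof v : herm_of_coord_mx v \is hermsymmx.
Proof.
apply/hermsymmxP=> i j; rewrite !mxE [j == i]eq_sym.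
have [->|ne_ij] := eqVneq i j; first by rewrite conjc_real.
by case: ltngtP => [//|//=|/val_inj e]; rewrite /= ?opprK // e eqxx in ne_ij *.
Qed.
Definition herm_of_coord v := Herm (herm_of_coord_subproof v).

Fact herm_vect_subproof : Vector.axiom (d * d) herm.
Proof.
exists herm_coord.
  move=> a H K; rewrite /herm_coord -linearP; congr mxvec.
  apply/matrixP=> i j; rewrite !mxE.
  case: (H i j) (K i j) => [x y] [z t]; case: ifP => _ /=.
    by rewrite !mul0r subr0.
  by rewrite !mul0r addr0.
exists herm_of_coord => [H|v].
  apply: val_inj; apply/matrixP=> i j; rewrite mxE /herm_coord mxvecK !mxE.
  have [<-|ne_ij] := eqVneq i j.
    rewrite leqnn; have := hermE H i i; case: (H i i) => x y /= [] /eqP.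
    by rewrite -addr_eq0 -mulr2n mulrn_eq0 /= => /eqP ->.
  rewrite (hermE H j i); case: (H i j) => x y /=.
  by case: ltngtP => [| |/val_inj e] //=; rewrite ?opprK // e eqxx in ne_ij *.
apply: (canLR vec_mxK); apply/matrixP=> i j.
rewrite [LHS]mxE /= [herm_of_coord_mx v i j]mxE.
have [<-|ne_ij] := eqVneq i j; first by rewrite leqnn.
by case: ltngtP => [| |/val_inj e] //=; rewrite e eqxx in ne_ij *.
Qed.
HB.instance Definition _ :=
  Lmodule_hasFinDim.Build R herm herm_vect_subproof.

Fact herm1_subproof : (1%:M : 'M[R[i]]_d) \is hermsymmx.
Proof. exact: hermitian1mx_subproof. Qed.
Definition herm1 : herm := Herm herm1_subproof.

Definition psd (H : herm) : Prop :=
  forall v : 'cV[R[i]]_d, 0 <= (v ^t* *m H *m v) 0 0.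

(* The trace of a Hermitian matrix is real (mxtrace_herm). *)
Definition htrace (H : herm) : R^o := complex.Re (\tr (H : 'M_d)).

Lemma mxtrace_herm (H : herm) : \tr (H : 'M_d) = (htrace H)%:C.
Proof.
rewrite /htrace; suff: \tr (H : 'M_d) = (\tr (H : 'M_d))^*.
  case: (\tr _) => x y [] /eqP.
  by rewrite -addr_eq0 -mulr2n mulrn_eq0 /= => /eqP ->.
rewrite /mxtrace rmorph_sum; apply: eq_bigr => i _; exact: hermE.
Qed.

Fact htrace_is_linear : linear htrace.
Proof.
move=> a H K; rewrite /htrace hermDE hermZE mxtraceD mxtraceZ.
by case: (\tr _) (\tr _) => [x y] [z t] /=; rewrite mul0r subr0.
Qed.
HB.instance Definition _ := GRing.isLinear.Build R herm R^o _ htrace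
  htrace_is_linear.

Definition ZB : {vspace herm} := <[herm1]>%VS.
Definition CB : {vspace herm} := lker (linfun htrace).

Lemma mem_ZB (H : herm) : reflect (exists a : R, hermval H = a%:C%:M) (H \in ZB).
Proof.
have e a : val (a *: herm1) = a%:C%:M by rewrite /= scalemx1.
apply: (iffP (vlineP _ _)) => [[a ->]|[a Ha]]; exists a; first exact: e.
by apply: val_inj; rewrite e.
Qed.

Lemma mem_CB (H : herm) : (H \in CB) = (\tr (H : 'M_d) == 0).
Proof.
by rewrite memv_ker lfunE mxtrace_herm (fmorph_eq0 (real_complex R)).
Qed.

End HermitianSpace.

Arguments herm1 R d : clear implicits.
Arguments ZB R d : clear implicits.
Arguments CB R d : clear implicits.

Record cardinality := Cardinality {
  inputs : nat;
  outputs : 'I_inputs -> nat;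
  inputs_gt0 : (0 < inputs)%N;
  outputs_gt0 : forall x, (0 < outputs x)%N
}.

Definition events (A : cardinality) : finType :=
  {x : 'I_(inputs A) & 'I_(outputs x)}.

Definition event (A : cardinality) (x : 'I_(inputs A)) (a : 'I_(outputs x)) :
  events A := Tagged _ a.

Section DeviceSpace.
Variables (R : rcfType) (A : cardinality).

Definition device : vectType R := {ffun events A -> R^o}.

Definition ket (x : 'I_(inputs A)) (a : 'I_(outputs x)) : device :=
  [ffun e => (e == event a)%:R].

Fact last_output_subproof (x : 'I_(inputs A)) : ((outputs x).-1 < outputs x)%N.
Proof. by rewrite prednK ?outputs_gt0. Qed.
Definition last_output x : 'I_(outputs x) := Ordinal (last_output_subproof x).

Definition vecZ : device :=
  \sum_x \sum_(a < outputs x) (outputs x)%:R^-1 *: ket a.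

Definition vecC (x : 'I_(inputs A)) (i : 'I_(outputs x)) : device :=
  (outputs x)%:R^-1 *: (ket i - ket (last_output x)).

Definition ZA : {vspace device} := <[vecZ]>%VS.

(* Outputs are numbered from 0, so i < (outputs x).-1 is "not the last one". *)
Definition CA : {vspace device} :=
  (\sum_x \sum_(i < outputs x | (i < (outputs x).-1)%N) <[vecC i]>)%VS.

End DeviceSpace.

Arguments ket R {A x} a.
Arguments vecZ R A : clear implicits.
Arguments vecC R {A x} i.
Arguments ZA R A : clear implicits.
Arguments CA R A : clear implicits.

(* Since device R A is the coordinate space R^(events A), its tensor product
   with a real vector space W is modelled by W^(events A). *)
Section Tensor.
Variables (R : rcfType) (A : cardinality) (W : vectType R).

Definition tensor : vectType R := {ffun events A -> W}.

Definition tens (u : device R A) (w : W) : tensor :=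
  [ffun e => (u e : R) *: w].

Lemma tensDl u v w : tens (u + v) w = tens u w + tens v w.
Proof. by apply/ffunP=> e; rewrite !ffunE scalerDl. Qed.
Lemma tensDr u v w : tens u (v + w) = tens u v + tens u w.
Proof. by apply/ffunP=> e; rewrite !ffunE scalerDr. Qed.
Lemma tensZl (a : R) u w : tens (a *: u) w = a *: tens u w.
Proof. by apply/ffunP=> e; rewrite !ffunE scalerA. Qed.
Lemma tensZr (a : R) u w : tens u (a *: w) = a *: tens u w.
Proof. by apply/ffunP=> e; rewrite !ffunE !scalerA mulrC. Qed.

(* The span of the u (x) w with u in U and w in V, the least subspace
   containing them (tensvP). *)
Definition tensv (U : {vspace device R A}) (V : {vspace W}) : {vspace tensor} :=
  <<[seq tens u w | u <- vbasis U, w <- vbasis V]>>%VS.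

Lemma mem_tensv (U : {vspace device R A}) (V : {vspace W}) u w :
  u \in U -> w \in V -> tens u w \in tensv U V.
Proof.
move=> /coord_vbasis-> /coord_vbasis->.
rewrite (big_morph (tens^~ _) (fun u v => tensDl u v _) (_ : tens 0 _ = 0));
  last by apply/ffunP=> e; rewrite !ffunE scale0r.
apply: rpred_sum => i _; rewrite tensZl rpredZ //.
rewrite (big_morph (tens _) (tensDr _) (_ : tens _ 0 = 0));
  last by apply/ffunP=> e; rewrite !ffunE scaler0.
apply: rpred_sum => j _; rewrite tensZr rpredZ //.
by apply: memv_span; apply: allpairs_f; apply: mem_nth; rewrite size_tuple.
Qed.

Lemma tensvP (U : {vspace device R A}) (V : {vspace W})
    (S : {vspace tensor}) :
  reflect (forall u w, u \in U -> w \in V -> tens u w \in S)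
          (tensv U V <= S)%VS.
Proof.
apply: (iffP idP) => [/subvP sS u w uU wV|h]; first exact/sS/mem_tensv.
by apply/span_subvP=> _ /allpairsP[[u w] /= [/vbasis_mem uU /vbasis_mem wV ->]];
  apply: h.
Qed.

End Tensor.

Section Assemblages.
Variables (R : rcfType) (A : cardinality) (d : nat).

Definition operator_family :=
  forall x : 'I_(inputs A), 'I_(outputs x) -> herm R d.

Definition assemblage_tensor (s : operator_family) : tensor A (herm R d) :=
  \sum_x \sum_(a < outputs x) tens (ket R a) (s x a).

Definition quantum_assemblage (s : operator_family) : Prop :=
  [/\ forall x a, psd (s x a),
      forall x x', \sum_a s x a = \sum_a s x' a
    & (inputs A)%:R^-1 *
        (\sum_x \sum_(a < outputs x) \tr (s x a : 'M[R[i]]_d)) = 1].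

End Assemblages.

(* Main.v *)
(* Write sigma_B for the common value of sum_a sigma_(a|x); it has trace 1.
   Then sigma_(a|x) - sigma_B / A_x sums to 0 over a for every x, and the
   families with this property and entries in a subspace V form exactly
   C_A (x) V.  Splitting Hermitian matrices into scalar and traceless parts
   gives the decomposition.  The sum is direct because the marginals
   sum_a t_(a|x) recover c from Z_A (x) c but vanish on C_A (x) H_B. *)
From HB Require Import structures.
Require Import Defs.
From mathcomp Require Import all_boot all_order all_algebra complex reals.
Import GRing.Theory.
Local Open Scope ring_scope.

Section Tensors.
Context {R : rcfType} {A : cardinality}.

(** The dependent double sum is reindexed over [events A], where only the ket of [e] survives; this
    reads entries off [assemblage_tensor] and [vecZ]. *)
Lemma sum_ketE {W : vectType R}
    (f : forall x : 'I_(inputs A), 'I_(outputs x) -> W) (e : events A) :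
  (\sum_x \sum_(a < outputs x) tens (ket R a) (f x a)) e
    = f (tag e) (tagged e).
Proof.
have -> : \sum_x \sum_(a < outputs x) tens (ket R a) (f x a)
    = \sum_(p : events A) tens (ket R (tagged p)) (f (tag p) (tagged p)).
  exact: (sig_big_dep predT (fun _ => predT) (fun x a => tens (ket R a) (f x a))).
rewrite sum_ffunE (bigD1 e) //= big1 => [|p ne_pe]; rewrite !ffunE.
  by rewrite addr0 /event; case: e => x a /=; rewrite eqxx scale1r.
have -> : event (tagged p) = p by case: p {ne_pe}.
by rewrite eq_sym (negPf ne_pe) scale0r.
Qed.

Lemma tensor_ketE {W : vectType R} (t : tensor A W) :
  t = \sum_x \sum_(a < outputs x) tens (ket R a) (t (event a)).
Proof.
apply/ffunP=> e; rewrite (sum_ketE (fun x a => t (event a))).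
by case: e.
Qed.

Lemma vecZE (e : events A) : vecZ R A e = (outputs (tag e))%:R^-1.
Proof.
have := sum_ketE (fun x (_ : 'I_(outputs x)) => (outputs x)%:R^-1 : R^o) e.
move=> <-; congr (fun_of_fin _ e).
apply: eq_bigr => x _; apply: eq_bigr => a _.
by apply/ffunP=> p; rewrite !ffunE /GRing.scale /= mulrC.
Qed.

Lemma output_neq0 (x : 'I_(inputs A)) : (outputs x)%:R != 0 :> R.
Proof. by rewrite Num.Theory.pnatr_eq0 -lt0n outputs_gt0. Qed.

(** With [W := R^o] this is a functional on the device space itself. It separates [ZA] from [CA],
    with value 1 on [vecZ] and 0 on every [vecC]. *)
Definition marginal {W : vectType R} (x : 'I_(inputs A)) (t : tensor A W) : W :=
  \sum_(a < outputs x) t (event a).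

Fact marginal_is_linear {W : vectType R} x : linear (@marginal W x).
Proof.
move=> k t u; rewrite /marginal scaler_sumr -big_split /=.
by apply: eq_bigr => a _; rewrite !ffunE.
Qed.
HB.instance Definition _ (W : vectType R) x :=
  GRing.isLinear.Build R (tensor A W) W _ (@marginal W x)
    (marginal_is_linear x).

Lemma marginal_tens {W : vectType R} x (u : device R A) (w : W) :
  marginal x (tens u w) = (marginal (W := R^o) x u : R) *: w.
Proof. by rewrite /marginal scaler_suml; apply: eq_bigr => a _; rewrite ffunE. Qed.

Lemma marginal_vecZ x : marginal (W := R^o) x (vecZ R A) = 1.
Proof.
rewrite /marginal (eq_bigr (fun=> (outputs x)%:R^-1)); last first.
  by move=> a _; rewrite vecZE.
by rewrite sumr_const card_ord -[LHS]scaler_nat; apply: divff (output_neq0 x).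
Qed.

Lemma marginal_ket x y (a : 'I_(outputs y)) :
  marginal (W := R^o) x (ket R a) = (x == y)%:R.
Proof.
rewrite /marginal; have [exy|ne_xy] := eqVneq x y; last first.
  rewrite big1 // => b _; rewrite ffunE.
  by case: eqP => [/(congr1 tag) /= /eqP|]; rewrite ?(negPf ne_xy).
case: _ / exy a => {y} a; rewrite (bigD1 a) //= big1 => [|b ne_ba].
  by rewrite !ffunE eqxx addr0.
by rewrite !ffunE /event eq_Tagged /= (negPf ne_ba).
Qed.

Fact tens_is_linear {W : vectType R} (u : device R A) :
  linear (tens u : W -> tensor A W).
Proof. by move=> k v w; rewrite tensDr tensZr. Qed.
HB.instance Definition _ (W : vectType R) (u : device R A) :=
  GRing.isLinear.Build R W (tensor A W) _ (tens u) (tens_is_linear u).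

Lemma tensv_entry {W : vectType R} {U : {vspace device R A}} {V : {vspace W}} {t} :
  t \in tensv U V -> forall e, t e \in V.
Proof.
move=> t_r e; pose r := [seq tens u w | u <- vbasis U, w <- vbasis V].
rewrite (@coord_span _ _ _ (in_tuple r) t t_r) sum_ffunE rpred_sum // => i _.
rewrite ffunE rpredZ //.
have /allpairsP[[u w] /= [_ /vbasis_mem wV ->]] := mem_nth 0 (ltn_ord i).
by rewrite ffunE rpredZ.
Qed.

(** Since [ZA] is a line, the scalar of the first factor moves to the second, so all generators lie
    in the image of a single linear map. *)
Lemma tensv_ZA {W : vectType R} {V : {vspace W}} {t} :
  t \in tensv (ZA R A) V -> exists w, t = tens (vecZ R A) w.
Proof.
suff /subvP sub : (tensv (ZA R A) V <= limg (linfun (tens (vecZ R A) : W -> _)))%VS.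
  by move=> /sub /memv_imgP[w _ ->]; exists w; rewrite lfunE.
apply/tensvP => u w /vlineP[k ->] _; rewrite tensZl -tensZr.
by apply/memv_imgP; exists (k *: w); rewrite ?memvf ?lfunE.
Qed.

(** Allowing the last output, which [CA] leaves out, only adds the zero vector; otherwise the factor
    [outputs x] undoes the normalization of [vecC]. *)
Lemma ket_sub_last_mem {x} (a : 'I_(outputs x)) :
  ket R a - ket R (last_output x) \in CA R A.
Proof.
have [lt_a|ge_a] := boolP (a < (outputs x).-1)%N; last first.
  suff -> : a = last_output x by rewrite subrr mem0v.
  by apply/val_inj/eqP; rewrite /= eqn_leq -ltnS prednK ?outputs_gt0 // ltn_ord leqNgt.
have -> : ket R a - ket R (last_output x) = (outputs x)%:R *: vecC R a.
  by rewrite scalerA divff ?scale1r ?output_neq0.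
rewrite rpredZ //; apply: (subvP (sumv_sup x _ (sumv_sup a _ (subvv _)))) => //.
exact: memv_line.
Qed.

Lemma tensv_CA {W : vectType R} {V : {vspace W}} {t} :
  t \in tensv (CA R A) V <-> (forall x, marginal x t = 0) /\ (forall e, t e \in V).
Proof.
split=> [tCV|[t0 tV]].
  split=> [x|]; last exact: (tensv_entry tCV).
  suff /subvP/(_ t tCV) : (tensv (CA R A) V <= lker (linfun (@marginal W x)))%VS.
    by rewrite memv_ker lfunE => /eqP.
  apply/tensvP => u w uC _.
  suff /subvP/(_ u uC) : (CA R A <= lker (linfun (@marginal R^o x)))%VS.
    by rewrite !memv_ker !lfunE /= marginal_tens => /eqP->; rewrite scale0r.
  apply/subv_sumP => y _; apply/subv_sumP => i _.
  rewrite -memvE memv_ker lfunE linearZ linearB /= !marginal_ket.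
  by rewrite subrr scaler0.
rewrite [t]tensor_ketE.
(* For each x the change is the last ket tensored with [marginal x t], which is zero. *)
have -> : \sum_x \sum_(a < outputs x) tens (ket R a) (t (event a))
    = \sum_x \sum_(a < outputs x)
        tens (ket R a - ket R (last_output x)) (t (event a)).
  apply: eq_bigr => x _.
  under [RHS]eq_bigr => a _ do rewrite tensDl -scaleN1r tensZl.
  rewrite big_split /= -scaler_sumr -linear_sum -/(marginal x t) t0.
  by rewrite linear0 scaler0 addr0.
rewrite rpred_sum // => x _; rewrite rpred_sum // => a _.
exact: mem_tensv (ket_sub_last_mem a) (tV _).
Qed.

End Tensors.

Section Traceless.
Context {R : rcfType} {d : nat}.
Context (d_gt0 : (0 < d)%N).

Let d_neq0 : d%:R != 0 :> R.
Proof. by rewrite Num.Theory.pnatr_eq0 -lt0n. Qed.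

Lemma htrace1 : htrace (herm1 R d) = d%:R.
Proof. by rewrite /htrace mxtrace1 -(rmorph_nat (real_complex R)). Qed.

(** For positive [d], the projection onto [ZB] along [CB]. *)
Definition scalar_part (H : herm R d) : herm R d :=
  (d%:R^-1 * (htrace H : R)) *: herm1 R d.

Fact scalar_part_is_linear : linear scalar_part.
Proof.
move=> k H K; rewrite /scalar_part linearP /= mulrDr scalerDl scalerA.
by congr (_ *: _ + _); rewrite mulrCA.
Qed.
HB.instance Definition _ :=
  GRing.isLinear.Build R (herm R d) (herm R d) _ scalar_part
    scalar_part_is_linear.

Lemma scalar_part_ZB H : scalar_part H \in ZB R d.
Proof. by rewrite rpredZ ?memv_line. Qed.

Lemma sub_scalar_part_CB H : H - scalar_part H \in CB R d.
Proof.
rewrite memv_ker lfunE /= linearB linearZ /= htrace1 /GRing.scale /=.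
by rewrite mulrAC mulVf // mul1r subrr.
Qed.

Lemma ZB_CB_eq0 {H} : H \in ZB R d -> H \in CB R d -> H = 0.
Proof.
move=> /vlineP[k ->]; rewrite memv_ker lfunE /= linearZ /= htrace1.
by rewrite /GRing.scale /= mulf_eq0 (negPf d_neq0) orbF => /eqP->; apply: scale0r.
Qed.

End Traceless.

(** The normalization averages the traces of the marginals over the inputs, and these marginals all
    coincide. *)
Lemma htrace_marginal {R : rcfType} {A : cardinality} {d : nat}
    {s : operator_family R A d} x :
  quantum_assemblage s -> htrace (\sum_a s x a) = 1.
Proof.
(* The two contrapositions cancel, leaving the normalization as the premise. *)
move=> [_ same_marginal]; apply: contra_eq => ne1; apply: contra_neq ne1.
under eq_bigr => y _ do
  (under eq_bigr => a _ do rewrite mxtrace_herm;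
   rewrite -rmorph_sum -linear_sum (same_marginal y x)).
rewrite sumr_const card_ord -[X in _ * X]mulr_natl mulKf.
  by move=> /complexI.
by rewrite Num.Theory.pnatr_eq0 -lt0n inputs_gt0.
Qed.

Theorem proposition14 (R : realType) (A : cardinality) (d : nat)
    (d_gt0 : (0 < d)%N) :
  directv (tensv (ZA R A) (CB R d) + tensv (CA R A) (ZB R d)
           + tensv (CA R A) (CB R d)) /\
  forall s : operator_family R A d, quantum_assemblage s ->
  exists2 Delta : tensor A (herm R d),
    Delta \in (tensv (ZA R A) (CB R d) + tensv (CA R A) (ZB R d)
               + tensv (CA R A) (CB R d))%VS
    & assemblage_tensor s = d%:R^-1 *: tens (vecZ R A) (herm1 R d) + Delta.
Proof.
pose x0 := Ordinal (inputs_gt0 A).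
split.
  have ZC_marginal t : t \in tensv (ZA R A) (CB R d) -> marginal x0 t = 0 -> t = 0.
    move=> /tensv_ZA[w ->]; rewrite marginal_tens marginal_vecZ scale1r => ->; exact: linear0.
  (* Two intersections must vanish: that of the first two summands, then that of their sum with the
     third. *)
  rewrite !directv_addE !directv_trivial /=.
  apply/andP; split; rewrite -subv0; apply/subvP=> t;
    rewrite memv_cap memv0.
    by move=> /andP[/ZC_marginal tZ /tensv_CA[t0 _]]; rewrite tZ.
  (* The marginal at [x0] forces [u] to vanish; the entries of [v] are then both scalar and
     traceless. *)
  move=> /andP[/memv_addP[u uZ [v /tensv_CA[v0 vZ] ->]] /tensv_CA[t0 tC]].
  have u0 : u = 0 by apply: ZC_marginal => //; have := t0 x0; rewrite linearD /= v0 addr0.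
  rewrite u0 add0r in tC *.
  by apply/eqP/ffunP=> e; rewrite (ZB_CB_eq0 d_gt0 (vZ e) (tC e)) ffunE.
move=> s qs; have [_ same_marginal _] := qs.
pose sB := \sum_a s x0 a.
pose t : tensor A (herm R d) := assemblage_tensor s - tens (vecZ R A) sB.
have marg_t x : marginal x t = 0.
  rewrite linearB /= marginal_tens marginal_vecZ scale1r /sB (same_marginal x0 x) /marginal.
  by under eq_bigr => a _ do rewrite sum_ketE; rewrite subrr.
(* Splitting [t] entrywise by a linear map keeps all marginals zero, so both parts stay over
   [CA]. *)
pose tZ : tensor A (herm R d) := [ffun e => scalar_part (t e)].
have marg_tZ x : marginal x tZ = 0.
  rewrite /marginal; under eq_bigr => a _ do rewrite ffunE.
  by rewrite -linear_sum -/(marginal x t) marg_t linear0.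
(* In order: the traceless part of [sB], the scalar part of [t], the traceless part of [t]. *)
exists (tens (vecZ R A) (sB - scalar_part sB) + tZ + (t - tZ)).
  rewrite !memv_add //.
  - by rewrite mem_tensv ?memv_line ?sub_scalar_part_CB.
  - by apply/tensv_CA; split=> // e; rewrite ffunE scalar_part_ZB.
  - apply/tensv_CA; split=> [x|e]; first by rewrite linearB /= marg_t marg_tZ subrr.
    by rewrite !ffunE sub_scalar_part_CB.
(* The constant 1/d appears because [sB] has trace 1. *)
have -> : d%:R^-1 *: tens (vecZ R A) (herm1 R d) = tens (vecZ R A) (scalar_part sB).
  by rewrite -tensZr /scalar_part (htrace_marginal x0 qs) mulr1.
by rewrite -addrA [tZ + _]addrC subrK addrA -tensDr [scalar_part sB + _]addrC subrK
  addrC subrK.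
Qed.
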